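(* Let $E$ be a generalized F-structure on $M$ with corresponding endomorphism $\Phi$, and let $L=im\,\Phi$, $S=\ker\Phi$. Then $E$ is integrable if and only if $\Phi$ satisfies one of the following two equivalent conditions: $$\mathcal{N}_\Phi(\mathcal{X},\mathcal{Y})=pr_S[\mathcal{X},\mathcal{Y}],\qquad\forall\mathcal{X},\mathcal{Y}\in\Gamma L,$$ $$\mathcal{S}_\Phi(\mathcal{X},\mathcal{Y})=[\Phi\mathcal{X},\Phi\mathcal{Y}]-[\Phi^2\mathcal{X},\Phi^2\mathcal{Y}]+\Phi[\Phi\mathcal{X},\Phi^2\mathcal{Y}]+\Phi[\Phi^2\mathcal{X},\Phi\mathcal{Y}]=0,\qquad\forall\mathcal{X},\mathcal{Y}\in\Gamma T^{big}M .$$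
   Context: $M$ is a $C^\infty$ manifold, $T^{big}M=TM\oplus T^*M$ with the neutral metric $g((X,\alpha),(Y,\beta))=\frac12(\alpha(Y)+\beta(X))$ and the Courant bracket $[(X,\alpha),(Y,\beta)]=([X,Y],L_X\beta-L_Y\alpha+\frac12 d(\alpha(Y)-\beta(X)))$, both extended complex (bi)linearly to $T^{big}_cM=T^{big}M\otimes\mathbb{C}$. A generalized F-structure is a complex $g$-isotropic subbundle $E\subseteq T^{big}_cM$ with $E\cap\bar E'=0$, where $E'=E^{\perp_g}$ and the bar is complex conjugation. It is integrable if $\Gamma(E)$ is closed under the Courant bracket. It corresponds to the real endomorphism $\Phi$ of $T^{big}M$ with eigenbundles $E,\bar E,S_c=E'\cap\bar E'$ for the eigenvalues $\sqrt{-1},-\sqrt{-1},0$, respectively ($S_c$ is the complexification of a real bundle $S=\ker\Phi$); $\Phi$ satisfies $\Phi^3+\Phi=0$ and is $g$-skew-symmetric. One has $T^{big}M=L\oplus S$ with $L=im\,\Phi$, and $pr_S=Id+\Phi^2$ is the projection onto $S$ along $L$. The Courant-Nijenhuis torsion is $\mathcal{N}_\Phi(\mathcal{X},\mathcal{Y})=[\Phi\mathcal{X},\Phi\mathcal{Y}]-\Phi[\Phi\mathcal{X},\mathcal{Y}]-\Phi[\mathcal{X},\Phi\mathcal{Y}]+\Phi^2[\mathcal{X},\mathcal{Y}]$, with Courant brackets. *)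

(* Defs.v *)
From HB Require Import structures.
From mathcomp Require Import all_boot all_order all_algebra.
From mathcomp Require Import all_classical all_reals all_analysis.
From mathcomp Require Import complex.

Set Implicit Arguments.
Unset Strict Implicit.
Unset Printing Implicit Defensive.

Import Order.TTheory GRing.Theory Num.Theory.
Import numFieldNormedType.Exports.
Import complex.

Local Open Scope classical_set_scope.
Local Open Scope ring_scope.

Fixpoint k_differentiable (R : realType) (n : nat) (W : normedModType R)
    (k : nat) (U : set 'rV[R]_n) (f : 'rV[R]_n -> W) : Prop :=
  if k is k'.+1 then
    (forall x, U x -> differentiable f x) /\
    (forall i : 'I_n, k_differentiable k' U ('D_(delta_mx 0 i) f))
  else True.

(* [k_differentiable k.+1 U f] implies that [f] is C^k on the open set [U], and
   conversely C^k functions are [k]-differentiable, so quantifying over [k]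
   gives the C^oo functions. *)
Definition smooth_in (R : realType) (n : nat) (W : normedModType R)
    (U : set 'rV[R]_n) (f : 'rV[R]_n -> W) : Prop :=
  forall k, k_differentiable k U f.

(* A homeomorphism [chart_map] from the open set [chart_dom] onto the open set
   [chart_map @` chart_dom].  Both total functions [chart_map] and [chart_inv]
   are irrelevant outside of these two sets. *)
Record chart (R : realType) (n : nat) (M : topologicalType) := Chart {
  chart_dom : set M;
  chart_map : M -> 'rV[R]_n;
  chart_inv : 'rV[R]_n -> M;
  chart_dom_open : open chart_dom;
  chart_img_open : open (chart_map @` chart_dom);
  chart_mapK : forall p, chart_dom p -> chart_inv (chart_map p) = p;
  chart_map_continuous : forall p, chart_dom p -> {for p, continuous chart_map};
  chart_inv_continuous : forall x, (chart_map @` chart_dom) x ->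
    {for x, continuous chart_inv}
}.

Definition transition (R : realType) (n : nat) (M : topologicalType)
    (c d : chart R n M) (x : 'rV[R]_n) : 'rV[R]_n :=
  chart_map d (chart_inv c x).

Record manifold (R : realType) (n : nat) := Manifold {
  carrier :> topologicalType;
  carrier_hausdorff : hausdorff_space carrier;
  carrier_second_countable : @second_countable carrier;
  atlas : set (chart R n carrier);
  atlas_cover : forall p : carrier, exists c, atlas c /\ chart_dom c p;
  atlas_compatible : forall c d, atlas c -> atlas d ->
    smooth_in (chart_map c @` (chart_dom c `&` chart_dom d)) (transition c d)
}.

(* The fibre of TM (+) T*M over [p] is realised as the space 'rV_(n + n) of the
   components [row_mx X alpha] of a vector [X] and a covector [alpha] with
   respect to a chart [chart_at p] around [p], fixed once and for all.  Row
   vectors are used throughout, so matrices act on the right. *)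
Definition chart_at (R : realType) (n : nat) (M : manifold R n) (p : M) :
    chart R n M :=
  sval (cid (atlas_cover p)).

(* Change of components at [p] from the chart [c] to the chart [d]: with
   y = transition c d x, one has X'^j = X^i dy^j/dx^i and
   alpha'_j = alpha_i dx^i/dy^j. *)
Definition change_of_chart (R : realType) (n : nat) (M : topologicalType)
    (c d : chart R n M) (p : M) : 'M[R]_(n + n) :=
  block_mx (jacobian (transition c d) (chart_map c p)) 0
           0 (jacobian (transition d c) (chart_map d p))^T.

(* Not required to be smooth. *)
Definition bigsection (R : realType) (n : nat) (M : manifold R n) : Type :=
  M -> 'rV[R]_(n + n).

Definition components (R : realType) (n : nat) (M : manifold R n)
    (V : bigsection M) (c : chart R n M) (x : 'rV[R]_n) : 'rV[R]_(n + n) :=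
  let p := chart_inv c x in V p *m change_of_chart (chart_at p) c p.

Definition smooth_section_on (R : realType) (n : nat) (M : manifold R n)
    (U : set M) (V : bigsection M) : Prop :=
  forall c, atlas c ->
    smooth_in (chart_map c @` (chart_dom c `&` U)) (components V c).

Definition smooth_section (R : realType) (n : nat) (M : manifold R n)
    (V : bigsection M) : Prop :=
  smooth_section_on setT V.

(* The matrix of the metric g((X,a),(Y,b)) = 1/2 (a(Y) + b(X)), over R or R[i]. *)
Definition neutral_metric (F : fieldType) (n : nat) : 'M[F]_(n + n) :=
  2^-1 *: block_mx 0 1%:M 1%:M 0.

Section LocalFormulas.
Context (R : realType) (n : nat).
Implicit Types (X Y alpha beta : 'rV[R]_n -> 'rV[R]_n) (x : 'rV[R]_n).

Definition pairing alpha X x : R := (alpha x *m (X x)^T) 0 0.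

Definition differential (f : 'rV[R]_n -> R) x : 'rV[R]_n :=
  \row_k 'D_(delta_mx 0 k) f x.

(* [X, Y]^k = X^i d_i Y^k - Y^i d_i X^k *)
Definition lie_bracket X Y x : 'rV[R]_n := 'D_(X x) Y x - 'D_(Y x) X x.

(* (L_X beta)_k = X^i d_i beta_k + beta_i d_k X^i *)
Definition lie_derivative X beta x : 'rV[R]_n :=
  'D_(X x) beta x + \row_k pairing beta ('D_(delta_mx 0 k) X) x.

Definition local_courant (V W : 'rV[R]_n -> 'rV[R]_(n + n)) x :
    'rV[R]_(n + n) :=
  let X := lsubmx \o V in let alpha := rsubmx \o V in
  let Y := lsubmx \o W in let beta := rsubmx \o W in
  row_mx (lie_bracket X Y x)
    (lie_derivative X beta x - lie_derivative Y alpha x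
     + 2^-1 *: differential (fun y => pairing alpha Y y - pairing beta X y) x).

End LocalFormulas.

(* At [p] the bracket is computed in the chart [chart_at p], whose components
   represent the fibre over [p]. *)
Definition courant (R : realType) (n : nat) (M : manifold R n)
    (V W : bigsection M) : bigsection M :=
  fun p => let c := chart_at p in
    local_courant (components V c) (components W c) (chart_map c p).

Definition to_complex (R : realType) (m k : nat) (A : 'M[R]_(m, k)) :
    'M[R[i]]_(m, k) :=
  map_mx (real_complex R) A.

Definition conj_mx (R : realType) (m k : nat) (A : 'M[R[i]]_(m, k)) :
    'M[R[i]]_(m, k) :=
  map_mx (@conjc R) A.

Definition cbigsection (R : realType) (n : nat) (M : manifold R n) : Type :=
  M -> 'rV[R[i]]_(n + n).

Definition re_section (R : realType) (n : nat) (M : manifold R n)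
    (e : cbigsection M) : bigsection M :=
  fun p => map_mx (@complex.Re R) (e p).

Definition im_section (R : realType) (n : nat) (M : manifold R n)
    (e : cbigsection M) : bigsection M :=
  fun p => map_mx (@complex.Im R) (e p).

Definition smooth_csection_on (R : realType) (n : nat) (M : manifold R n)
    (U : set M) (e : cbigsection M) : Prop :=
  smooth_section_on U (re_section e) /\ smooth_section_on U (im_section e).

Definition ccourant (R : realType) (n : nat) (M : manifold R n)
    (e f : cbigsection M) : cbigsection M :=
  fun p =>
    to_complex (courant (re_section e) (re_section f) p
                - courant (im_section e) (im_section f) p)
    + 'i%C *: to_complex (courant (re_section e) (im_section f) p
                          + courant (im_section e) (re_section f) p).

(* A family of complex subspaces of the fibres is given by a family of square
   matrices, the subspace over [p] being the row space of [E p].  A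
   subbundle is one that has smooth local frames; its rank is locally
   constant. *)
Definition csubbundle (R : realType) (n : nat) (M : manifold R n)
    (E : M -> 'M[R[i]]_(n + n)) : Prop :=
  forall p : M, exists (U : set M) (k : nat) (e : 'I_k -> cbigsection M),
    [/\ open U, U p, forall i, smooth_csection_on U (e i) &
        forall q, U q ->
          let frame := \matrix_(i < k) e i q in
          row_free frame /\ (frame :=: E q)%MS].

(* The subspace {v | v *m g *m A^T = 0}. *)
Definition orthogonal_mx (F : fieldType) (n m : nat) (A : 'M[F]_(m, n + n)) :
    'M[F]_(n + n) :=
  kermx (neutral_metric F n *m A^T).

Definition generalized_F_structure (R : realType) (n : nat) (M : manifold R n)
    (E : M -> 'M[R[i]]_(n + n)) : Prop :=
  [/\ csubbundle E,
      forall p, (E p <= orthogonal_mx (E p))%MS &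
      forall p, (E p :&: conj_mx (orthogonal_mx (E p)))%MS = 0].

Definition section_of (R : realType) (n : nat) (M : manifold R n)
    (E : M -> 'M[R[i]]_(n + n)) (e : cbigsection M) : Prop :=
  smooth_csection_on setT e /\ forall p, (e p <= E p)%MS.

Definition integrable_structure (R : realType) (n : nat) (M : manifold R n)
    (E : M -> 'M[R[i]]_(n + n)) : Prop :=
  forall e f : cbigsection M,
    section_of E e -> section_of E f -> section_of E (ccourant e f).

(* A field of endomorphisms of the big tangent bundle; it is smooth when its
   matrix in every chart is. *)
Definition smooth_endomorphism (R : realType) (n : nat) (M : manifold R n)
    (Phi : M -> 'M[R]_(n + n)) : Prop :=
  forall c, atlas c ->
    smooth_in (chart_map c @` chart_dom c) (fun x =>
      let p := chart_inv c x in
      change_of_chart c (chart_at p) p *m Phi p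
        *m change_of_chart (chart_at p) c p).

Definition corresponding_endomorphism (R : realType) (n : nat)
    (M : manifold R n) (E : M -> 'M[R[i]]_(n + n))
    (Phi : M -> 'M[R]_(n + n)) : Prop :=
  smooth_endomorphism Phi /\
  forall p,
    [/\ (eigenspace (to_complex (Phi p)) 'i%C :=: E p)%MS,
        (eigenspace (to_complex (Phi p)) (- 'i%C) :=: conj_mx (E p))%MS &
        (eigenspace (to_complex (Phi p)) 0 :=:
           orthogonal_mx (E p) :&: conj_mx (orthogonal_mx (E p)))%MS].

Definition apply_endo (R : realType) (n : nat) (M : manifold R n)
    (Phi : M -> 'M[R]_(n + n)) (V : bigsection M) : bigsection M :=
  fun p => V p *m Phi p.

(* Smooth sections of L = im Phi: in row notation the image of [Phi p] is its
   row space, and its kernel is [kermx (Phi p)]. *)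
Definition section_of_image (R : realType) (n : nat) (M : manifold R n)
    (Phi : M -> 'M[R]_(n + n)) (V : bigsection M) : Prop :=
  smooth_section V /\ forall p, (V p <= Phi p)%MS.

(* The projection onto S = ker Phi along L = im Phi. *)
Definition pr_S (R : realType) (n : nat) (M : manifold R n)
    (Phi : M -> 'M[R]_(n + n)) (V : bigsection M) : bigsection M :=
  fun p => V p *m proj_mx (kermx (Phi p)) (Phi p).

Definition nijenhuis (R : realType) (n : nat) (M : manifold R n)
    (Phi : M -> 'M[R]_(n + n)) (V W : bigsection M) : bigsection M :=
  let F := apply_endo Phi in
  fun p => courant (F V) (F W) p - F (courant (F V) W) p
           - F (courant V (F W)) p + F (F (courant V W)) p.

Definition S_tensor (R : realType) (n : nat) (M : manifold R n)
    (Phi : M -> 'M[R]_(n + n)) (V W : bigsection M) : bigsection M :=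
  let F := apply_endo Phi in
  fun p => courant (F V) (F W) p - courant (F (F V)) (F (F W)) p
           + F (courant (F V) (F (F W))) p + F (courant (F (F V)) (F W)) p.

(* Main.v *)
(** A section of [E] is [Phi^2 V + i Phi V] with [V] real, so comparing the
    real and imaginary parts of [[e, f] Phi = i [e, f]] turns closure of the
    sections of [E] under the bracket into [S_Phi = 0]; the second of the two
    resulting equations is the first one for another pair of sections. Moreover
    [S_Phi (V, W)] depends only on [Phi V] and [Phi W], and on sections of [L],
    where [Phi^2 = - Id], the equation [S_Phi = 0] is the Nijenhuis condition
    because [pr_S = Id + Phi^2].

    Integrability also demands that the bracket of smooth sections be smooth.
    Since [courant] evaluates the bracket at each point in a chart chosen
    arbitrarily, this amounts to its invariance under changes of charts, which
    rests on the symmetry of second derivatives. *)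

Require Import Defs.
From mathcomp Require Import all_boot all_order all_algebra.
From mathcomp Require Import all_classical all_reals all_analysis.
From mathcomp Require Import complex.

Set Implicit Arguments.
Unset Strict Implicit.
Unset Printing Implicit Defensive.

Import Order.TTheory GRing.Theory Num.Theory.
Import numFieldNormedType.Exports.
Import complex.

Local Open Scope classical_set_scope.
Local Open Scope ring_scope.

(** * Matrix-valued functions *)

Section Calculus.
Context {R : realType} {V : normedModType R}.

(** Differentiability at a point depends only on the germ: [g] is [f] plus a function that vanishes
    near [x], and such a function has the zero map as differential. *)
Lemma near_eq_differentiable (W : normedModType R) (f g : V -> W) (x : V) :
  (\near x, f x = g x) -> differentiable f x -> differentiable g x.
Proof.
move=> fg df.
suff dh : differentiable (g - f) x.
  have -> : g = f + (g - f) by apply/funext => y; rewrite !fctE subrKC.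
  exact: differentiableD.
have h0 : \forall y \near x, (g - f) y = 0.
  by apply: filterS fg => y fgy; rewrite !fctE fgy subrr.
have hexp : (g - f) \o shift x = cst ((g - f) x) + (\0 : V -> W) +o_ 0 id.
  apply/eqaddoP => e e0 /=.
  have := h0; rewrite (near_shift 0 x) /= subr0 => h1.
  apply: filterS h1 => y; rewrite !fctE /= => ->. 
  have := nbhs_singleton h0; rewrite !fctE => ->.
  by rewrite addr0 subrr normr0 mulr_ge0// ltW.
have h1 : continuous (\0 : {linear V -> W}) by move=> ?; exact: cst_continuous.
(* Uniqueness identifies the differential of [g - f] at [x] with the zero map, after which [hexp] is
   the expansion that differentiability asks for. *)
have := diff_unique h1 hexp.
by move=> E; apply/diff_locallyP; rewrite E.
Qed.

Lemma differentiable_mx m n (M : V -> 'M[R]_(m, n)) x :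
  differentiable M x <-> forall i j, differentiable (fun y => M y i j) x.
Proof.
split=> [dM i j|dM].
  apply: (@differentiable_comp _ _ _ _ M (fun N : 'M[R]_(m, n) => N i j)) => //.
  exact: differentiable_coord.
(* Expansion in elementary matrices: each term is a scalar function times a constant matrix. *)
have -> : M = \sum_(i < m) \sum_(j < n) (fun y => M y i j *: delta_mx i j).
  apply/funext => y; rewrite fct_sumE [LHS]matrix_sum_delta.
  by apply: eq_bigr => i _; rewrite fct_sumE.
apply: differentiable_sum => i; apply: differentiable_sum => j.
exact: differentiableZl.
Qed.

Lemma derive_linear (W W' : normedModType R) (L : {linear W -> W'})
    (f : V -> W) x v : continuous L -> differentiable f x ->
  'D_v (fun y => L (f y)) x = L ('D_v f x).
Proof.
move=> cL df; have dL y : differentiable L y by exact: linear_differentiable.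
rewrite deriveE; last exact: (differentiable_comp df (dL _)).
by rewrite (diff_comp df (dL _)) /= diff_lin // deriveE.
Qed.

Lemma derive_coord m n (M : V -> 'M[R]_(m, n)) x v i j :
  differentiable M x -> ('D_v M x) i j = 'D_v (fun y => M y i j) x.
Proof. by move=> dM; rewrite derive_mx ?mxE//; exact: diff_derivable. Qed.

Lemma differentiable_mulmx m n p (A : V -> 'M[R]_(m, n))
    (B : V -> 'M[R]_(n, p)) x : differentiable A x -> differentiable B x ->
  differentiable (fun y => A y *m B y) x.
Proof.
move=> /differentiable_mx dA /differentiable_mx dB.
apply/differentiable_mx => i j.
have -> : (fun y => (A y *m B y) i j) =
    \sum_k ((fun y => A y i k) * (fun y => B y k j)).
  by apply/funext => y; rewrite mxE fct_sumE.
by apply: differentiable_sum => k; apply: differentiableM.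
Qed.

Lemma derive_mulmx m n p (A : V -> 'M[R]_(m, n)) (B : V -> 'M[R]_(n, p)) x v :
  differentiable A x -> differentiable B x ->
  'D_v (fun y => A y *m B y) x = 'D_v A x *m B x + A x *m 'D_v B x.
Proof.
move=> dA dB; apply/matrixP => i j.
rewrite derive_coord; last exact: differentiable_mulmx.
have -> : (fun y => (A y *m B y) i j) =
    \sum_k ((fun y => A y i k) * (fun y => B y k j)).
  by apply/funext => y; rewrite mxE fct_sumE.
have dAij k : derivable (fun y => A y i k) x v.
  by apply: diff_derivable; exact: (differentiable_mx _ _).1.
have dBij k : derivable (fun y => B y k j) x v.
  by apply: diff_derivable; exact: (differentiable_mx _ _).1.
rewrite derive_sum => [|k]; last exact: derivableM.
rewrite !mxE -big_split; apply: eq_bigr => k _ /=.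
rewrite deriveM// -!derive_coord// addrC; congr (_ + _).
exact: mulrC.
Qed.

Lemma differentiable_trmx m n (A : V -> 'M[R]_(m, n)) x :
  differentiable A x -> differentiable (fun y => (A y)^T) x.
Proof.
move=> /differentiable_mx dA; apply/differentiable_mx => i j.
by under eq_fun do rewrite mxE.
Qed.

Lemma derive_trmx m n (A : V -> 'M[R]_(m, n)) x v :
  differentiable A x -> 'D_v (fun y => (A y)^T) x = ('D_v A x)^T.
Proof.
move=> dA; apply/matrixP => i j.
rewrite derive_coord; last exact: differentiable_trmx.
by rewrite mxE derive_coord//; under eq_fun do rewrite mxE.
Qed.

End Calculus.

(** * Symmetry of second derivatives *)

Section Schwarz.
Context {R : realType} {V : normedModType R}.
Implicit Types (f : V -> R) (x v w a : V).

(** The difference quotients of the restriction to the line are literally those of [f] in direction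
    [v], so one-variable calculus applies to ['D_v f]. *)
Lemma is_derive_line f a v (s : R) : derivable f (s *: v + a) v ->
  is_derive s 1 (fun r => f (r *: v + a)) ('D_v f (s *: v + a)).
Proof.
have E : (fun h : R => h^-1 *: (((fun r => f (r *: v + a)) \o shift s) (h *: 1)
            - f (s *: v + a))) =
         (fun h : R => h^-1 *: ((f \o shift (s *: v + a)) (h *: v)
            - f (s *: v + a))).
  by apply/funext => h /=; rewrite [h *: 1]mulr1 scalerDl addrA.
by move=> df; split; rewrite /derivable /derive E.
Qed.

Lemma mean_value_line f a v (h : R) : 0 < h ->
  (forall s, s \in `[0, h] -> derivable f (s *: v + a) v) ->
  exists2 s, s \in `[0, h] & f (h *: v + a) - f a = 'D_v f (s *: v + a) * h.
Proof.
move=> h0 df.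
have sub s : s \in `]0, h[ -> s \in `[0, h].
  by rewrite !in_itv /= => /andP[/ltW-> /ltW->].
have [|c ch] := MVT h0 (fun s sh => is_derive_line (df s (sub s sh))).
  apply: derivable_within_continuous => s sh.
  exact: (@ex_derive _ _ _ _ _ _ _ (is_derive_line (df s sh))).
by rewrite scale0r add0r subr0 => E; exists c => //; exact: sub.
Qed.

(** Two uses of the mean value theorem: along [v] for the increment [g] of [f] under translation by
    [h *: w], then along [w] for ['D_v f]. The left-hand side is symmetric in [v] and [w], which is
    what yields Schwarz's theorem. *)
Lemma second_difference f x v w (h : R) : 0 < h ->
  (forall s t, s \in `[0, h] -> t \in `[0, h] ->
    derivable f (s *: v + (t *: w + x)) v /\
    derivable ('D_v f) (s *: v + (t *: w + x)) w) ->
  exists s t, [/\ s \in `[0, h], t \in `[0, h] &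
    f (h *: v + (h *: w + x)) - f (h *: v + x) - (f (h *: w + x) - f x) =
    'D_w ('D_v f) (s *: v + (t *: w + x)) * h * h].
Proof.
move=> h0 df.
have in0 : 0 \in `[0, h] by rewrite in_itv /= lexx ltW.
have inh : h \in `[0, h] by rewrite in_itv /= lexx ltW.
pose g y := f (y + h *: w) - f y.
have dgl s : s \in `[0, h] ->
    derivable (fun y => f (y + h *: w)) (s *: v + x) v /\
    'D_v (fun y => f (y + h *: w)) (s *: v + x) =
    'D_v f (s *: v + (h *: w + x)).
  move=> sh; have [d1 _] := df s h sh inh.
  have E : (fun k : R => k^-1 *: (((fun y => f (y + h *: w)) \o
              shift (s *: v + x)) (k *: v) - f (s *: v + x + h *: w))) =
           (fun k : R => k^-1 *: ((f \o shift (s *: v + (h *: w + x))) (k *: v)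
            - f (s *: v + (h *: w + x)))).
    apply/funext => k /=; congr (_ *: (f _ - f _)).
      by rewrite -!addrA [x + _]addrC.
    by rewrite -addrA [x + _]addrC.
  by split; rewrite /derivable /derive E.
have df0 s : s \in `[0, h] -> derivable f (s *: v + x) v.
  by move=> sh; have [+ _] := df s 0 sh in0; rewrite scale0r add0r.
have dg s : s \in `[0, h] -> derivable g (s *: v + x) v.
  by move=> sh; apply: derivableB; [case: (dgl s sh)|exact: df0].
have [s sh Es] := mean_value_line h0 dg.
have dDf t : t \in `[0, h] -> derivable ('D_v f) (t *: w + (s *: v + x)) w.
  by move=> th; have [_] := df s t sh th; rewrite addrCA.
have [t th Et] := mean_value_line h0 dDf.
exists s, t; split => //.
have [dgs Edgs] := dgl s sh.
rewrite [s *: v + (t *: w + x)]addrCA -Et [h *: w + (s *: v + x)]addrCA -Edgs.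
rewrite -deriveB//; last exact: df0.
(* What remains is that both sides list the same four corners of the parallelogram. *)
rewrite -[_ - _ in RHS]/g -Es /g; congr (f _ - f _ - (f _ - f _)).
  by rewrite addrAC addrA.
by rewrite addrC.
Qed.

(** Schwarz's theorem. By the symmetry of the second difference, the two mixed derivatives take a
    common value at two points that can be chosen as close to [x] as desired; continuity at [x] then
    puts their values at [x] within any [e] of each other. *)
Lemma derive_sym f x v w :
  (\near x, [/\ derivable f x v, derivable f x w,
     derivable ('D_v f) x w & derivable ('D_w f) x v]) ->
  {for x, continuous ('D_w ('D_v f))} ->
  {for x, continuous ('D_v ('D_w f))} ->
  'D_w ('D_v f) x = 'D_v ('D_w f) x.
Proof.
move=> df c1 c2; apply/eqP; rewrite -subr_eq0 -normr_le0.
apply/ler_addgt0Pr => e e0; rewrite add0r.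
have e20 : 0 < e / 2 by rewrite divr_gt0.
have [r r0 Hr] : exists2 r : R, 0 < r & forall y, `|x - y| < r ->
   [/\ [/\ derivable f y v, derivable f y w,
     derivable ('D_v f) y w & derivable ('D_w f) y v],
     `|'D_w ('D_v f) x - 'D_w ('D_v f) y| < e / 2 &
     `|'D_v ('D_w f) x - 'D_v ('D_w f) y| < e / 2].
  have n1 : \forall y \near x, `|'D_w ('D_v f) x - 'D_w ('D_v f) y| < e / 2.
    exact: (cvgrPdist_lt _ _).1 c1 _ e20.
  have n2 : \forall y \near x, `|'D_v ('D_w f) x - 'D_v ('D_w f) y| < e / 2.
    exact: (cvgrPdist_lt _ _).1 c2 _ e20.
  have /nbhs_ballP[r /= r0 H] : \forall y \near x,
      [/\ [/\ derivable f y v, derivable f y w,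
     derivable ('D_v f) y w & derivable ('D_w f) y v],
     `|'D_w ('D_v f) x - 'D_w ('D_v f) y| < e / 2 &
     `|'D_v ('D_w f) x - 'D_v ('D_w f) y| < e / 2].
    by apply: filterS3 df n1 n2 => y; split.
  exists r; first exact: r0.
  move=> y xy; have xry : ball x r y by rewrite -ball_normE; exact: xy.
  exact: (H y xry).
(* The summand 1 keeps the denominator positive when [v] and [w] vanish, and the factor 1/2 makes
   the parallelogram lie strictly within distance [r] of [x]. *)
pose h := r / 2 / (`|v| + `|w| + 1).
have nvw : 0 < `|v| + `|w| + 1 by rewrite ltr_pwDr// addr_ge0.
have h0 : 0 < h by rewrite !divr_gt0.
have near_x s t : s \in `[0, h] -> t \in `[0, h] ->
    `|x - (s *: v + (t *: w + x))| < r.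
  rewrite !in_itv /= => /andP[s0 sh] /andP[t0 th].
  rewrite addrA opprD addrCA subrr addr0 normrN.
  apply: (le_lt_trans (ler_normD _ _)).
  rewrite !normrZ !ger0_norm//.
  apply: (@le_lt_trans _ _ (h * (`|v| + `|w| + 1))).
    rewrite !mulrDr mulr1 -[leLHS]addr0; apply: lerD; last exact: ltW.
    by apply: lerD; apply: ler_wpM2r.
  by rewrite /h divfK ?gt_eqF// ltr_pdivrMr// ltr_pMr// ltr1n.
have [|s [t [sh th E1]]] := @second_difference f x v w h h0.
  by move=> s t sh th; have [[]] := Hr _ (near_x s t sh th).
have near_x' s' t' : s' \in `[0, h] -> t' \in `[0, h] ->
    `|x - (s' *: w + (t' *: v + x))| < r.
  by move=> sh' th'; rewrite addrCA; apply: near_x.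
have [|s' [t' [sh' th' E2]]] := @second_difference f x w v h h0.
  by move=> s' t' sh' th'; have [[]] := Hr _ (near_x' s' t' sh' th').
have E : 'D_w ('D_v f) (s *: v + (t *: w + x)) =
         'D_v ('D_w f) (s' *: w + (t' *: v + x)).
  have hN0 : h != 0 by rewrite gt_eqF.
  apply: (mulIf hN0); apply: (mulIf hN0).
  rewrite (addrCA (h *: w)) in E2.
  apply: etrans (esym E1) _; apply: etrans _ E2.
  by rewrite !opprD !opprK addrACA.
have [_ + _] := Hr _ (near_x s t sh th).
have [_ _] := Hr _ (near_x' s' t' sh' th').
(* Only four real numbers matter from here on, two of them equal: the triangle inequality through
   this common value [b] concludes. *)
move: E; generalize ('D_w ('D_v f) (s *: v + (t *: w + x))).
generalize ('D_v ('D_w f) (s' *: w + (t' *: v + x))).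
generalize ('D_w ('D_v f) x) ('D_v ('D_w f) x) => p q b _ -> Hb Ha.
have tri (a c : R) : `|a - b| < e / 2 -> `|c - b| < e / 2 -> `|a - c| <= e.
  move=> /ltW Ha' /ltW; rewrite distrC => Hb'.
  by rewrite -(subrKA b) (le_trans (ler_normD _ _))// [leRHS]splitr lerD.
exact: tri Ha Hb.
Qed.

End Schwarz.

(** * Smooth functions *)

Section Smooth.
Context {R : realType} {n : nat}.
Implicit Types (U : set 'rV[R]_n) (x v : 'rV[R]_n).

Lemma open_near U x (P : set 'rV[R]_n) : open U -> U x ->
  (forall y, U y -> P y) -> \near x, P x.
Proof. by move=> oU Ux UP; apply: (filterS UP); exact: open_nbhs_nbhs. Qed.

(** As [U] is open, equality on [U] is equality near each of its points, so all derivatives agree on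
    [U] as well. *)
Lemma k_differentiable_eq (W : normedModType R) k U (f g : 'rV[R]_n -> W) :
  open U -> (forall x, U x -> f x = g x) ->
  k_differentiable k U f -> k_differentiable k U g.
Proof.
move=> oU; elim: k f g => //= k IH f g fg [df Df].
have nfg x : U x -> \near x, f x = g x by move=> Ux; exact: open_near oU Ux fg.
split=> [x Ux|i]; first exact: near_eq_differentiable (nfg x Ux) (df x Ux).
by apply: IH (Df i) => x Ux; apply: near_eq_derive; exact: nfg.
Qed.

Lemma k_differentiableW (W : normedModType R) k U (f : 'rV[R]_n -> W) :
  k_differentiable k.+1 U f -> k_differentiable k U f.
Proof.
elim: k f => // k IH f [df Df]; split=> // i; exact/IH/Df.
Qed.

Lemma k_differentiableD (W : normedModType R) k U (f g : 'rV[R]_n -> W) :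
  open U -> k_differentiable k U f -> k_differentiable k U g ->
  k_differentiable k U (fun x => f x + g x).
Proof.
move=> oU; elim: k f g => //= k IH f g [df Df] [dg Dg].
split=> [x Ux|i]; first by apply: differentiableD; [exact: df|exact: dg].
apply: k_differentiable_eq oU _ (IH _ _ (Df i) (Dg i)) => x Ux.
by rewrite deriveD//; apply: diff_derivable; [exact: df|exact: dg].
Qed.

Lemma k_differentiable_cst (W : normedModType R) k U (a : W) :
  k_differentiable k U (fun=> a).
Proof.
elim: k a => //= k IH a; split=> [x _|i]; first exact: differentiable_cst.
by rewrite (_ : 'D_ _ _ = fun=> 0) //; apply/funext => x; exact: derive_cst.
Qed.

Lemma k_differentiable_linear (W W' : normedModType R) (L : {linear W -> W'})
    k U (f : 'rV[R]_n -> W) : open U -> continuous L ->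
  k_differentiable k U f -> k_differentiable k U (fun x => L (f x)).
Proof.
move=> oU cL; elim: k f => //= k IH f [df Df]; split=> [x Ux|i].
  apply: (@differentiable_comp _ _ _ _ f L); first exact: df.
  exact: linear_differentiable.
apply: k_differentiable_eq oU _ (IH _ (Df i)) => x Ux.
by rewrite derive_linear//; exact: df.
Qed.

Lemma k_differentiableM k U (f g : 'rV[R]_n -> R) : open U ->
  k_differentiable k U f -> k_differentiable k U g ->
  k_differentiable k U (fun x => f x * g x).
Proof.
move=> oU; elim: k f g => // k IH f g sf sg.
have [df Df] := sf; have [dg Dg] := sg.
split=> [x Ux|i]; first by apply: differentiableM; [exact: df|exact: dg].
(* The product rule involves [f] and [g] themselves next to their derivatives, so the induction
   hypothesis is applied to them at one order less. *)
have H := k_differentiableD oU (IH _ _ (k_differentiableW sf) (Dg i))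
  (IH _ _ (k_differentiableW sg) (Df i)).
apply: k_differentiable_eq oU _ H => x Ux.
by rewrite deriveM//; apply: diff_derivable; [exact: df|exact: dg].
Qed.

Lemma k_differentiable_mx m p k U (M : 'rV[R]_n -> 'M[R]_(m, p)) : open U ->
  k_differentiable k U M <->
  forall i j, k_differentiable k U (fun x => M x i j).
Proof.
move=> oU; elim: k M => [|k IH] M; first by split.
split=> [[dM DM] i j|H].
  split=> [x Ux|l]; first exact: (differentiable_mx _ _).1 (dM x Ux) i j.
  have := (IH _).1 (DM l) i j; apply: k_differentiable_eq oU _ => x Ux.
  by rewrite derive_coord//; exact: dM.
have dM x : U x -> differentiable M x.
  by move=> Ux; apply/differentiable_mx => i j; have [+ _] := H i j; exact.
split=> // l; apply/IH => i j; have [_ /(_ l)] := H i j.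
by apply: k_differentiable_eq oU _ => x Ux; rewrite derive_coord//; exact: dM.
Qed.

Section SmoothIn.
Variable U : set 'rV[R]_n.
Hypothesis oU : open U.

Lemma smooth_in_differentiable (W : normedModType R) (f : 'rV[R]_n -> W) x :
  smooth_in U f -> U x -> differentiable f x.
Proof. by move=> /(_ 1) [df _] /df. Qed.

Lemma smooth_in_eq (W : normedModType R) (f g : 'rV[R]_n -> W) :
  (forall x, U x -> f x = g x) -> smooth_in U f -> smooth_in U g.
Proof. by move=> fg sf k; exact: k_differentiable_eq oU fg (sf k). Qed.

Lemma smooth_inD (W : normedModType R) (f g : 'rV[R]_n -> W) :
  smooth_in U f -> smooth_in U g -> smooth_in U (fun x => f x + g x).
Proof. by move=> sf sg k; exact: k_differentiableD. Qed.

Lemma smooth_in_linear (W W' : normedModType R) (L : {linear W -> W'})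
    (f : 'rV[R]_n -> W) : continuous L ->
  smooth_in U f -> smooth_in U (fun x => L (f x)).
Proof. by move=> cL sf k; exact: k_differentiable_linear. Qed.

Lemma smooth_in_mx m p (M : 'rV[R]_n -> 'M[R]_(m, p)) :
  smooth_in U M <-> forall i j, smooth_in U (fun x => M x i j).
Proof.
split=> [sM i j k|sM k]; first exact: (k_differentiable_mx _ _ oU).1 (sM k) i j.
by apply/k_differentiable_mx => // i j; exact: sM.
Qed.

Lemma smooth_inN m p (A : 'rV[R]_n -> 'M[R]_(m, p)) :
  smooth_in U A -> smooth_in U (fun x => - A x).
Proof. by apply: (@smooth_in_linear _ _ -%R); exact: opp_continuous. Qed.

Lemma smooth_inB m p (A B : 'rV[R]_n -> 'M[R]_(m, p)) :
  smooth_in U A -> smooth_in U B -> smooth_in U (fun x => A x - B x).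
Proof. by move=> sA sB; apply: smooth_inD => //; exact: smooth_inN. Qed.

Lemma smooth_in_scale (W : normedModType R) (a : R) (f : 'rV[R]_n -> W) :
  smooth_in U f -> smooth_in U (fun x => a *: f x).
Proof.
by apply: (@smooth_in_linear _ _ (GRing.scale a)); exact: scaler_continuous.
Qed.

Lemma smooth_in_sum (W : normedModType R) I (r : seq I)
    (F : I -> 'rV[R]_n -> W) :
  (forall i, smooth_in U (F i)) -> smooth_in U (fun x => \sum_(i <- r) F i x).
Proof.
move=> sF; elim: r => [|i r IH].
  by move=> k; under eq_fun do rewrite big_nil; exact: k_differentiable_cst.
by under eq_fun do rewrite big_cons; exact: smooth_inD.
Qed.

Lemma smooth_in_mulmx m p q (A : 'rV[R]_n -> 'M[R]_(m, p))
    (B : 'rV[R]_n -> 'M[R]_(p, q)) :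
  smooth_in U A -> smooth_in U B -> smooth_in U (fun x => A x *m B x).
Proof.
move=> /smooth_in_mx sA /smooth_in_mx sB; apply/smooth_in_mx => i j.
under eq_fun do rewrite mxE; apply: smooth_in_sum => l k.
by apply: k_differentiableM => //; [exact: sA|exact: sB].
Qed.

Lemma smooth_in_trmx m p (A : 'rV[R]_n -> 'M[R]_(m, p)) :
  smooth_in U A -> smooth_in U (fun x => (A x)^T).
Proof.
move=> /smooth_in_mx sA; apply/smooth_in_mx => i j.
under eq_fun do rewrite mxE.
exact: sA.
Qed.

Lemma smooth_in_lsubmx m p q (A : 'rV[R]_n -> 'M[R]_(m, p + q)) :
  smooth_in U A -> smooth_in U (fun x => lsubmx (A x)).
Proof.
move=> /smooth_in_mx sA; apply/smooth_in_mx => i j.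
under eq_fun do rewrite mxE.
exact: sA.
Qed.

Lemma smooth_in_rsubmx m p q (A : 'rV[R]_n -> 'M[R]_(m, p + q)) :
  smooth_in U A -> smooth_in U (fun x => rsubmx (A x)).
Proof.
move=> /smooth_in_mx sA; apply/smooth_in_mx => i j.
under eq_fun do rewrite mxE.
exact: sA.
Qed.

Lemma smooth_in_row_mx m p q (A : 'rV[R]_n -> 'M[R]_(m, p))
    (B : 'rV[R]_n -> 'M[R]_(m, q)) :
  smooth_in U A -> smooth_in U B -> smooth_in U (fun x => row_mx (A x) (B x)).
Proof.
move=> /smooth_in_mx sA /smooth_in_mx sB; apply/smooth_in_mx => i j.
under eq_fun do rewrite mxE.
by case: (fintype.split j) => l; [exact: sA|exact: sB].
Qed.

(** Smoothness is defined through partial derivatives; a general direction is reached by linearity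
    of the differential. *)
Lemma smooth_in_derive (W : normedModType R) (f : 'rV[R]_n -> W) v :
  smooth_in U f -> smooth_in U ('D_v f).
Proof.
move=> sf; have sDf i : smooth_in U ('D_(delta_mx 0 i) f).
  by move=> k; have [_ Df] := sf k.+1; exact: Df.
have : smooth_in U (fun x => \sum_i v 0 i *: 'D_(delta_mx 0 i) f x).
  by apply: smooth_in_sum => i; exact: smooth_in_scale.
apply: smooth_in_eq => x /(smooth_in_differentiable sf) df.
rewrite [in RHS](row_sum_delta v) deriveE// linear_sum; apply: eq_bigr => i _.
by rewrite linearZ -deriveE.
Qed.

Lemma row_jacobian p (f : 'rV[R]_n -> 'rV[R]_p) x i : differentiable f x ->
  row i (jacobian f x) = 'D_(delta_mx 0 i) f x.
Proof. by move=> df; rewrite rowE deriveEjacobian. Qed.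

Lemma smooth_in_jacobian p (f : 'rV[R]_n -> 'rV[R]_p) :
  smooth_in U f -> smooth_in U (jacobian f).
Proof.
move=> sf; apply/smooth_in_mx => i j.
have /smooth_in_mx/(_ 0 j) := smooth_in_derive (delta_mx 0 i) sf.
apply: smooth_in_eq => x Ux.
by rewrite -row_jacobian ?mxE//; exact: smooth_in_differentiable sf Ux.
Qed.

Lemma jacobian_comp p q (f : 'rV[R]_n -> 'rV[R]_p)
    (g : 'rV[R]_p -> 'rV[R]_q) x :
  differentiable f x -> differentiable g (f x) ->
  jacobian (g \o f) x = jacobian f x *m jacobian g (f x).
Proof.
move=> df dg; apply/row_matrixP => i; rewrite row_mul row_jacobian; last first.
  exact: differentiable_comp.
rewrite deriveE; last exact: differentiable_comp.
by rewrite diff_comp//= -!deriveE// deriveEjacobian// row_jacobian.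
Qed.

(** Schwarz's theorem for each component of [f]: the entry [j] of [w *m 'D_v (jacobian f) x] is the
    derivative along [v] of the derivative along [w] of the component [fj]. *)
Lemma smooth_in_derive_sym p (f : 'rV[R]_n -> 'rV[R]_p) x v w :
  smooth_in U f -> U x ->
  w *m 'D_v (jacobian f) x = v *m 'D_w (jacobian f) x.
Proof.
move=> sf Ux; have sJ := smooth_in_jacobian sf.
have dJ y : U y -> differentiable (jacobian f) y.
  exact: smooth_in_differentiable.
apply/rowP => j; pose fj y := f y 0 j.
have sfj : smooth_in U fj by exact: (smooth_in_mx f).1.
have sD u := smooth_in_derive u sfj.
have sDD u u' := smooth_in_derive u' (sD u).
have ddfj u u' : 'D_u' ('D_u fj) x = (u *m 'D_u' (jacobian f) x) 0 j.
  rewrite (@near_eq_derive _ _ _ _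
    (fun z => (u *m jacobian f z) 0 j)); last first.
    apply: open_near oU Ux _ => z /(smooth_in_differentiable sf) dfz.
    by rewrite -derive_coord// deriveEjacobian.
  rewrite -derive_coord; last first.
    by apply: differentiable_mulmx; [exact: differentiable_cst|exact: dJ].
  rewrite derive_mulmx; [|exact: differentiable_cst|exact: dJ].
  by rewrite derive_cst mul0mx add0r.
have dd (g : 'rV[R]_n -> R) u y : smooth_in U g -> U y -> derivable g y u.
  by move=> sg Uy; apply: diff_derivable; exact: smooth_in_differentiable sg Uy.
apply: etrans (esym (ddfj w v)) _; apply: etrans _ (ddfj v w).
apply: derive_sym.
- by apply: (open_near oU Ux) => y Uy; split; exact: dd.
- by apply: differentiable_continuous; exact: smooth_in_differentiable Ux.
- by apply: differentiable_continuous; exact: smooth_in_differentiable Ux.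
Qed.

End SmoothIn.
End Smooth.

(** * The Courant bracket in coordinates *)

Section LocalCourant.
Context {R : realType} {n : nat}.
Implicit Types (X Y alpha beta : 'rV[R]_n -> 'rV[R]_n) (x : 'rV[R]_n).

Lemma lie_bracketE X Y x : differentiable X x -> differentiable Y x ->
  lie_bracket X Y x = X x *m jacobian Y x - Y x *m jacobian X x.
Proof. by move=> dX dY; rewrite /lie_bracket !deriveEjacobian. Qed.

Lemma lie_derivativeE X beta x : differentiable X x -> differentiable beta x ->
  lie_derivative X beta x = X x *m jacobian beta x + beta x *m (jacobian X x)^T.
Proof.
move=> dX dbeta; rewrite /lie_derivative deriveEjacobian//; congr (_ + _).
apply/rowP => k; rewrite !mxE /pairing mxE; apply: eq_bigr => i _.
by rewrite -row_jacobian// !mxE.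
Qed.

Lemma differentiable_pairing alpha X x :
  differentiable alpha x -> differentiable X x ->
  differentiable (pairing alpha X) x.
Proof.
move=> da dX; apply: (differentiable_mx (fun y => alpha y *m (X y)^T) _).1.
by apply: differentiable_mulmx => //; exact: differentiable_trmx.
Qed.

(** The chain rule for covectors: written as rows, they are pulled back by the transpose of the
    Jacobian. *)
Lemma differential_comp (f : 'rV[R]_n -> R) (T : 'rV[R]_n -> 'rV[R]_n) x :
  differentiable T x -> differentiable f (T x) ->
  differential (f \o T) x = differential f (T x) *m (jacobian T x)^T.
Proof.
move=> dT df; apply/rowP => k; rewrite [LHS]mxE deriveE; last first.
  exact: differentiable_comp.
rewrite diff_comp//= -(deriveE _ dT) -(row_jacobian k dT).
move: (jacobian T x) => J.
rewrite [in LHS](row_sum_delta (row k J)) linear_sum mxE.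
apply: eq_bigr => i _.
by rewrite linearZ /= -deriveE// !mxE mulrC.
Qed.

(** * Behaviour of the bracket under a change of coordinates *)

Section Change.
Variables (U : set 'rV[R]_n) (T : 'rV[R]_n -> 'rV[R]_n) (x : 'rV[R]_n).
Hypotheses (oU : open U) (sT : smooth_in U T) (Ux : U x).

Let dT y : U y -> differentiable T y.
Proof. exact: smooth_in_differentiable. Qed.

Let dJ : differentiable (jacobian T) x.
Proof. exact: smooth_in_differentiable (smooth_in_jacobian oU sT) Ux. Qed.

Lemma near_eq_jacobian p (f g : 'rV[R]_n -> 'rV[R]_p) :
  (forall y, U y -> f y = g y) -> differentiable f x ->
  jacobian f x = jacobian g x.
Proof.
move=> fg df; have nfg := open_near oU Ux fg.
have dg : differentiable g x by exact: near_eq_differentiable df.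
apply/row_matrixP => i.
apply: etrans (row_jacobian i df) _; apply: etrans _ (esym (row_jacobian i dg)).
exact: (near_eq_derive _ nfg).
Qed.

(* The symmetry of the second derivative of [T] brings its contribution into a
   form that cancels in both [lie_bracket_change] and [lie_derivative_change]. *)
Lemma jacobian_vector_change X X' :
  (forall y, U y -> X' (T y) = X y *m jacobian T y) ->
  differentiable X x -> differentiable X' (T x) ->
  jacobian X x *m jacobian T x =
  jacobian T x *m jacobian X' (T x) - 'D_(X x) (jacobian T) x.
Proof.
move=> XX' dX dX'.
have dXT : differentiable (X' \o T) x.
  by apply: differentiable_comp => //; exact: dT.
have dXJ : differentiable (fun y => X y *m jacobian T y) x.
  exact: differentiable_mulmx.
(* The Jacobian of [y |-> X y *m jacobian T y] is computed twice: here by the chain rule through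
   [X'], below by the product rule, row by row. *)
have E := etrans (esym (near_eq_jacobian XX' dXT)) (jacobian_comp (dT Ux) dX').
apply/row_matrixP => i.
have S := smooth_in_derive_sym oU (delta_mx 0 i) (X x) sT Ux.
have Ei := etrans (esym (row_jacobian i dXJ)) (congr1 (row i) E).
have := etrans (esym (derive_mulmx (delta_mx 0 i) dX dJ)) Ei.
have := esym (row_jacobian i dX).
move: S; move: ('D_(X x) (jacobian T) x) ('D_(delta_mx 0 i) (jacobian T) x).
move: (jacobian T x) (jacobian X x) (jacobian X' (T x)) ('D_(delta_mx 0 i) X x).
move=> J JX JX' DX DJX DJi -> ->; rewrite -row_mul raddfB /= => <-.
by rewrite [row i DJX]rowE addrK.
Qed.

(** The second-order terms [X x *m 'D_(Y x) (jacobian T) x] and [Y x *m 'D_(X x) (jacobian T) x]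
    arise with opposite signs and are equal by symmetry. *)
Lemma lie_bracket_change X Y X' Y' :
  (forall y, U y -> X' (T y) = X y *m jacobian T y) ->
  (forall y, U y -> Y' (T y) = Y y *m jacobian T y) ->
  differentiable X x -> differentiable Y x ->
  differentiable X' (T x) -> differentiable Y' (T x) ->
  lie_bracket X' Y' (T x) = lie_bracket X Y x *m jacobian T x.
Proof.
move=> XX' YY' dX dY dX' dY'; rewrite !lie_bracketE//.
rewrite XX'// YY'//.
have := jacobian_vector_change XX' dX dX'.
have := jacobian_vector_change YY' dY dY'.
have := smooth_in_derive_sym oU (Y x) (X x) sT Ux.
move: ('D_(X x) (jacobian T) x) ('D_(Y x) (jacobian T) x).
move: (jacobian T x) (jacobian X x) (jacobian Y x) (jacobian X' (T x)).
move: (jacobian Y' (T x)) => JY' J JX JY JX' DX DY S EY EX.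
by rewrite mulmxBl -!mulmxA EX EY !mulmxBr S opprB addrA subrK.
Qed.

(** Differentiating the Jacobian in [beta] gives a second-order term that the one from the Jacobian
    of [X] cancels. Covectors are related by pull-back, which avoids inverting the Jacobian of
    [T]. *)
Lemma lie_derivative_change X X' beta beta' :
  (forall y, U y -> X' (T y) = X y *m jacobian T y) ->
  (forall y, U y -> beta y = beta' (T y) *m (jacobian T y)^T) ->
  differentiable X x -> differentiable beta x ->
  differentiable X' (T x) -> differentiable beta' (T x) ->
  lie_derivative X beta x = lie_derivative X' beta' (T x) *m (jacobian T x)^T.
Proof.
move=> XX' bb' dX db dX' db'; rewrite !lie_derivativeE//.
have dbT : differentiable (beta' \o T) x.
  by apply: differentiable_comp => //; exact: dT.
have Ebeta : 'D_(X x) beta x =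
    X x *m jacobian (beta' \o T) x *m (jacobian T x)^T
    + beta' (T x) *m ('D_(X x) (jacobian T) x)^T.
  apply: etrans (near_eq_derive _ (open_near oU Ux bb')) _.
  apply: etrans (derive_mulmx _ dbT (differentiable_trmx dJ)) _.
  by rewrite (deriveEjacobian _ dbT) (derive_trmx _ dJ).
have := etrans (esym (deriveEjacobian (X x) db)) Ebeta.
have := jacobian_comp (dT Ux) db'.
have := jacobian_vector_change XX' dX dX'.
rewrite (XX' x Ux) (bb' x Ux).
move: ('D_(X x) (jacobian T) x) (jacobian T x) (jacobian X x).
move: (jacobian beta x) (jacobian X' (T x)) (jacobian beta' (T x)).
move: (jacobian (beta' \o T) x) => Jc Jb JX' Jb' DX J JX EX -> ->.
rewrite mulmxDl -[beta' (T x) *m _ *m _]mulmxA -trmx_mul EX raddfB /= trmx_mul.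
by rewrite mulmxBr !mulmxA -addrA [X in _ + X]addrC subrK.
Qed.

Lemma local_courant_change (V W V' W' : 'rV[R]_n -> 'rV[R]_(n + n)) K :
  (forall y, U y -> lsubmx (V' (T y)) = lsubmx (V y) *m jacobian T y) ->
  (forall y, U y -> lsubmx (W' (T y)) = lsubmx (W y) *m jacobian T y) ->
  (forall y, U y -> rsubmx (V y) = rsubmx (V' (T y)) *m (jacobian T y)^T) ->
  (forall y, U y -> rsubmx (W y) = rsubmx (W' (T y)) *m (jacobian T y)^T) ->
  differentiable V x -> differentiable W x ->
  differentiable V' (T x) -> differentiable W' (T x) ->
  jacobian T x *m K = 1%:M ->
  local_courant V' W' (T x) =
  local_courant V W x *m block_mx (jacobian T x) 0 0 K^T.
Proof.
move=> VV'l WW'l VV'r WW'r dV dW dV' dW' JK.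
have dl (Z : 'rV[R]_n -> 'rV[R]_(n + n)) y : differentiable Z y ->
    differentiable (lsubmx \o Z) y.
  by move=> dZ; apply: differentiable_comp => //; exact: differentiable_lsubmx.
have dr (Z : 'rV[R]_n -> 'rV[R]_(n + n)) y : differentiable Z y ->
    differentiable (rsubmx \o Z) y.
  by move=> dZ; apply: differentiable_comp => //; exact: differentiable_rsubmx.
rewrite /local_courant mul_row_block !mulmx0 addr0 add0r; congr row_mx.
  by apply: lie_bracket_change => //; [exact: dl|exact: dl|exact: dl|exact: dl].
set C' := (LHS); set C := (X in _ = X *m _).
(* As [K] is inverse to the Jacobian, pushing the covector part forward by [K^T] undoes a pull-back,
   so the pulled-back form suffices. *)
suff -> : C = C' *m (jacobian T x)^T.
  by rewrite -mulmxA -trmx_mul (mulmx1C JK) trmx1 mulmx1.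
rewrite /C /C'.
have EVW : lie_derivative (lsubmx \o V) (rsubmx \o W) x =
    lie_derivative (lsubmx \o V') (rsubmx \o W') (T x) *m (jacobian T x)^T.
  by apply: lie_derivative_change => //; (exact: dl || exact: dr).
have EWV : lie_derivative (lsubmx \o W) (rsubmx \o V) x =
    lie_derivative (lsubmx \o W') (rsubmx \o V') (T x) *m (jacobian T x)^T.
  by apply: lie_derivative_change => //; (exact: dl || exact: dr).
set f' := fun y => pairing (rsubmx \o V') (lsubmx \o W') y -
                   pairing (rsubmx \o W') (lsubmx \o V') y.
set f := fun y => pairing (rsubmx \o V) (lsubmx \o W) y -
                  pairing (rsubmx \o W) (lsubmx \o V) y.
(* The pairing of a covector with a vector is invariant, so [f] is [f' \o T] on [U] and its
   differential is pulled back. *)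
have Ef : differential f x = differential f' (T x) *m (jacobian T x)^T.
  rewrite -differential_comp; [|exact: dT|]; last first.
    by apply: differentiableB; apply: differentiable_pairing;
      (exact: dl || exact: dr).
  apply/rowP => k; rewrite !mxE; apply: near_eq_derive.
  apply: (open_near oU Ux) => y Uy; rewrite /f /f' /pairing /=.
  by rewrite VV'r// WW'r// VV'l// WW'l// !trmx_mul !mulmxA.
have mulmx_combination (a b d a' b' d' : 'rV[R]_n) (J : 'M[R]_n) :
    a = a' *m J -> b = b' *m J -> d = d' *m J ->
    a - b + 2^-1 *: d = (a' - b' + 2^-1 *: d') *m J.
  by move=> -> -> ->; rewrite mulmxDl mulmxBl -scalemxAl.
exact: mulmx_combination EVW EWV Ef.
Qed.

End Change.

(** * Smoothness of the bracket in coordinates *)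

Lemma smooth_in_differential (U : set 'rV[R]_n) (f : 'rV[R]_n -> R) :
  open U -> smooth_in U f -> smooth_in U (differential f).
Proof.
move=> oU sf; apply/smooth_in_mx => // i j.
by under eq_fun do rewrite mxE; exact: smooth_in_derive.
Qed.

Lemma smooth_in_pairing (U : set 'rV[R]_n) alpha X : open U ->
  smooth_in U alpha -> smooth_in U X -> smooth_in U (pairing alpha X).
Proof.
move=> oU sa sX; apply: (smooth_in_mx oU (fun y => alpha y *m (X y)^T)).1.
by apply: smooth_in_mulmx => //; exact: smooth_in_trmx.
Qed.

Lemma smooth_in_lie_bracket (U : set 'rV[R]_n) X Y : open U ->
  smooth_in U X -> smooth_in U Y -> smooth_in U (lie_bracket X Y).
Proof.
move=> oU sX sY.
have : smooth_in U (fun x => X x *m jacobian Y x - Y x *m jacobian X x).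
  by apply: smooth_inB => //; apply: smooth_in_mulmx => //;
    exact: smooth_in_jacobian.
apply: smooth_in_eq => // x Ux; rewrite lie_bracketE//;
  exact: smooth_in_differentiable Ux.
Qed.

Lemma smooth_in_lie_derivative (U : set 'rV[R]_n) X beta : open U ->
  smooth_in U X -> smooth_in U beta -> smooth_in U (lie_derivative X beta).
Proof.
move=> oU sX sb.
have : smooth_in U
    (fun x => X x *m jacobian beta x + beta x *m (jacobian X x)^T).
  apply: smooth_inD => //; apply: smooth_in_mulmx => //.
    exact: smooth_in_jacobian.
  by apply: smooth_in_trmx => //; exact: smooth_in_jacobian.
apply: smooth_in_eq => // x Ux; rewrite lie_derivativeE//;
  exact: smooth_in_differentiable Ux.
Qed.

Lemma smooth_in_local_courant (U : set 'rV[R]_n)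
    (V W : 'rV[R]_n -> 'rV[R]_(n + n)) : open U ->
  smooth_in U V -> smooth_in U W -> smooth_in U (local_courant V W).
Proof.
move=> oU sV sW.
have sl (Z : 'rV[R]_n -> 'rV[R]_(n + n)) : smooth_in U Z ->
    smooth_in U (lsubmx \o Z : _ -> 'rV[R]_n).
  exact: smooth_in_lsubmx.
have sr (Z : 'rV[R]_n -> 'rV[R]_(n + n)) : smooth_in U Z ->
    smooth_in U (rsubmx \o Z : _ -> 'rV[R]_n).
  exact: smooth_in_rsubmx.
apply: smooth_in_row_mx => //.
  by apply: smooth_in_lie_bracket => //; exact: sl.
apply: smooth_inD => //.
  by apply: smooth_inB => //; apply: smooth_in_lie_derivative => //;
    (exact: sl || exact: sr).
apply: smooth_in_scale => //; apply: smooth_in_differential => //.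
have sp (A B : 'rV[R]_n -> 'rV[R]_(n + n)) : smooth_in U A -> smooth_in U B ->
    smooth_in U (pairing (rsubmx \o A) (lsubmx \o B)).
  by move=> sA sB; apply: smooth_in_pairing => //; [exact: sr|exact: sl].
apply: smooth_inD => //; first exact: sp.
have := sp _ _ sW sV.
by apply: (@smooth_in_linear _ _ _ oU _ _ -%R); exact: opp_continuous.
Qed.

(** * Signs in the bracket *)

Lemma jacobianN p (f : 'rV[R]_n -> 'rV[R]_p) x :
  differentiable f x -> jacobian (fun y => - f y) x = - jacobian f x.
Proof.
move=> df.
have dNf : differentiable (fun y => - f y) x by exact: differentiableN.
apply/row_matrixP => i; apply: etrans (row_jacobian i dNf) _.
rewrite raddfN /=; apply: etrans _ (congr1 -%R (esym (row_jacobian i df))).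
by apply: deriveN; exact: diff_derivable.
Qed.

Lemma differentialN (f : 'rV[R]_n -> R) x : differentiable f x ->
  differential (fun y => - f y) x = - differential f x.
Proof.
move=> df; apply/rowP => k; rewrite !mxE.
by apply: deriveN; exact: diff_derivable.
Qed.

Lemma local_courantC (V W : 'rV[R]_n -> 'rV[R]_(n + n)) x :
  differentiable V x -> differentiable W x ->
  local_courant W V x = - local_courant V W x.
Proof.
move=> dV dW; rewrite /local_courant.
set f := fun y => pairing (rsubmx \o V) (lsubmx \o W) y -
                  pairing (rsubmx \o W) (lsubmx \o V) y.
have df : differentiable f x.
  apply: differentiableB; apply: differentiable_pairing;
  by apply: differentiable_comp => //;
    (exact: differentiable_lsubmx || exact: differentiable_rsubmx).
have -> : (fun y => pairing (rsubmx \o W) (lsubmx \o V) y -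
                    pairing (rsubmx \o V) (lsubmx \o W) y) = (fun y => - f y).
  by apply/funext => y; rewrite opprB.
have -> := differentialN df.
rewrite opp_row_mx; congr row_mx; first by rewrite /lie_bracket opprB.
move: (lie_derivative _ _ x) (lie_derivative _ _ x) (differential f x).
by move=> a b d; rewrite scalerN opprD opprB.
Qed.

(** The factor -1 is the one that comes out of the brackets when [Phi^2] is replaced by [- Id] on
    [L]; being constant, it produces no derivative terms. *)
Lemma local_courantNl (V W : 'rV[R]_n -> 'rV[R]_(n + n)) x :
  differentiable V x -> differentiable W x ->
  local_courant (fun y => - V y) W x = - local_courant V W x.
Proof.
move=> dV dW; rewrite /local_courant.
set f := fun y => pairing (rsubmx \o V) (lsubmx \o W) y -
                  pairing (rsubmx \o W) (lsubmx \o V) y.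
have dl (Z : 'rV[R]_n -> 'rV[R]_(n + n)) : differentiable Z x ->
    differentiable (lsubmx \o Z : _ -> 'rV[R]_n) x.
  by move=> dZ; apply: differentiable_comp => //; exact: differentiable_lsubmx.
have dr (Z : 'rV[R]_n -> 'rV[R]_(n + n)) : differentiable Z x ->
    differentiable (rsubmx \o Z : _ -> 'rV[R]_n) x.
  by move=> dZ; apply: differentiable_comp => //; exact: differentiable_rsubmx.
have df : differentiable f x.
  by apply: differentiableB; apply: differentiable_pairing;
    (exact: dl || exact: dr).
have -> : lsubmx \o (fun y => - V y) = (fun y => - lsubmx (V y)).
  by apply/funext => y; rewrite /= raddfN.
have -> : rsubmx \o (fun y => - V y) = (fun y => - rsubmx (V y)).
  by apply/funext => y; rewrite /= raddfN.
have -> : (fun y => pairing (fun y => - rsubmx (V y)) (lsubmx \o W) y -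
   pairing (rsubmx \o W) (fun y => - lsubmx (V y)) y) = (fun y => - f y).
  apply/funext => y; rewrite /f /pairing mulNmx linearN /= mulmxN !mxE opprK.
  by rewrite opprB addrC.
have -> := differentialN df.
have dNl : differentiable (fun y => - lsubmx (V y)) x.
  by apply: (@differentiableN _ _ _ (lsubmx \o V)); exact: dl.
have dNr : differentiable (fun y => - rsubmx (V y)) x.
  by apply: (@differentiableN _ _ _ (rsubmx \o V)); exact: dr.
rewrite opp_row_mx; congr row_mx.
  rewrite !lie_bracketE//; [|exact: dl|exact: dl|exact: dl].
  have -> := jacobianN (dl V dV).
  by rewrite mulNmx mulmxN opprK opprB addrC.
rewrite !lie_derivativeE//;
  [|exact: dl|exact: dr|exact: dl|exact: dr|exact: dl|exact: dr].
have -> := jacobianN (dl V dV).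
have -> := jacobianN (dr V dV).
rewrite /=; move: (jacobian _ x) (jacobian _ x) (jacobian _ x) (jacobian _ x).
move=> A B C D.
rewrite !mulNmx !mulmxN [(- _)^T]raddfN /= mulmxN scalerN.
by rewrite !opprD.
Qed.

End LocalCourant.

(** * Change of charts *)

Section Charts.
Context {R : realType} {n : nat} {M : manifold R n}.
Implicit Types (c d e : chart R n M) (p : M) (V W : bigsection M).

(** Near an image point, [chart_inv] is continuous and takes values in the domain of [c], so the
    condition of lying in [O] pulls back to a neighbourhood. *)
Lemma open_chart_image c (O : set M) : open O ->
  open (chart_map c @` (chart_dom c `&` O)).
Proof.
move=> oO; rewrite openE => _ [p [cp Op] <-].
have img : (chart_map c @` chart_dom c) (chart_map c p) by exists p.
have near_img : \forall y \near chart_map c p, (chart_map c @` chart_dom c) y.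
  exact: open_nbhs_nbhs (conj (@chart_img_open _ _ _ c) img).
have near_inv : \forall y \near chart_map c p, O (chart_inv c y).
  apply: (chart_inv_continuous img); rewrite chart_mapK//.
  exact: open_nbhs_nbhs.
apply: filterS2 near_img near_inv => y [q cq <-]; rewrite chart_mapK// => Oq.
by exists q.
Qed.

Lemma open_chart_overlap c d :
  open (chart_map c @` (chart_dom c `&` chart_dom d)).
Proof. exact: open_chart_image (@chart_dom_open _ _ _ d). Qed.

Lemma open_chart_codomain c : open (chart_map c @` chart_dom c).
Proof. exact: chart_img_open. Qed.

Lemma transitionE c d p : chart_dom c p ->
  transition c d (chart_map c p) = chart_map d p.
Proof. by move=> cp; rewrite /transition chart_mapK. Qed.

Lemma differentiable_transition c d p : atlas c -> atlas d ->
  chart_dom c p -> chart_dom d p ->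
  differentiable (transition c d) (chart_map c p).
Proof.
move=> ac ad cp dp.
by apply: (smooth_in_differentiable (atlas_compatible ac ad)); exists p.
Qed.

Lemma jacobian_transition_comp c d e p : atlas c -> atlas d -> atlas e ->
  chart_dom c p -> chart_dom d p -> chart_dom e p ->
  'J (transition c e) (chart_map c p) =
  'J (transition c d) (chart_map c p) *m 'J (transition d e) (chart_map d p).
Proof.
move=> ac ad ae cp dp ep.
have dcd := differentiable_transition ac ad cp dp.
have dce := differentiable_transition ac ae cp ep.
have dde := differentiable_transition ad ae dp ep.
rewrite -(transitionE d cp) in dde.
(* Both sides evaluate the total function [chart_map e], so they agree on the whole overlap of [c]
   and [d], an open set around the point. *)
have comp : forall y, (chart_map c @` (chart_dom c `&` chart_dom d)) y ->
    transition c e y = (transition d e \o transition c d) y.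
  by move=> _ [q [cq dq] <-] /=; rewrite !transitionE.
have inU : (chart_map c @` (chart_dom c `&` chart_dom d)) (chart_map c p).
  by exists p.
apply: etrans (near_eq_jacobian (@open_chart_overlap c d) inU comp dce) _.
by apply: etrans (jacobian_comp dcd dde) _; rewrite transitionE.
Qed.

Lemma jacobian_transition_id c p : chart_dom c p ->
  'J (transition c c) (chart_map c p) = 1%:M.
Proof.
move=> cp.
have idE : forall y, (chart_map c @` chart_dom c) y -> id y = transition c c y.
  by move=> _ [q cq <-]; rewrite transitionE.
have inU : (chart_map c @` chart_dom c) (chart_map c p) by exists p.
have did : differentiable (id : 'rV[R]_n -> 'rV[R]_n) (chart_map c p) by [].
apply: etrans (esym (near_eq_jacobian (@open_chart_codomain c) inU idE did)) _.
apply/row_matrixP => i; apply: etrans (row_jacobian i did) _.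
by rewrite derive_id row1.
Qed.

Lemma jacobian_inverse c d p : atlas c -> atlas d ->
  chart_dom c p -> chart_dom d p ->
  'J (transition c d) (chart_map c p) *m 'J (transition d c) (chart_map d p) =
  1%:M.
Proof.
move=> ac ad cp dp.
apply: etrans (esym (jacobian_transition_comp ac ad ac cp dp cp)) _.
exact: jacobian_transition_id.
Qed.

Lemma change_of_chart_comp c d e p : atlas c -> atlas d -> atlas e ->
  chart_dom c p -> chart_dom d p -> chart_dom e p ->
  change_of_chart c d p *m change_of_chart d e p = change_of_chart c e p.
Proof.
move=> ac ad ae cp dp ep; rewrite /change_of_chart mulmx_block.
rewrite !mulmx0 !mul0mx !addr0 add0r -trmx_mul.
have E1 := esym (jacobian_transition_comp ac ad ae cp dp ep).
(* The covector block transposes the Jacobians of the reverse transitions, so it composes in the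
   order [e], [d], [c]. *)
have E2 := esym (jacobian_transition_comp ae ad ac ep dp cp).
have block_mx_eq (A A' B B' : 'M[R]_n) : A = A' -> B = B' ->
  block_mx A 0 0 B^T = block_mx A' 0 0 B'^T by move=> -> ->.
exact: block_mx_eq E1 E2.
Qed.

Lemma change_of_chart_id c p : chart_dom c p -> change_of_chart c c p = 1%:M.
Proof.
have block_mx_id (J : 'M[R]_n) : J = 1%:M ->
    block_mx J 0 0 J^T = 1%:M :> 'M[R]_(n + n).
  by move=> ->; rewrite trmx1 -scalar_mx_block.
by move=> cp; exact: block_mx_id (jacobian_transition_id cp).
Qed.

Lemma atlas_chart_at p : atlas (chart_at p).
Proof. by rewrite /chart_at; case: cid => /= c []. Qed.

Lemma chart_dom_chart_at p : chart_dom (chart_at p) p.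
Proof. by rewrite /chart_at; case: cid => /= c []. Qed.

Lemma componentsE V c p : chart_dom c p ->
  components V c (chart_map c p) = V p *m change_of_chart (chart_at p) c p.
Proof. by move=> cp; rewrite /components chart_mapK. Qed.

Lemma components_change V c d p : atlas c -> atlas d ->
  chart_dom c p -> chart_dom d p ->
  components V d (chart_map d p) =
  components V c (chart_map c p) *m change_of_chart c d p.
Proof.
move=> ac ad cp dp; rewrite (componentsE V cp) (componentsE V dp) -mulmxA.
have aa := atlas_chart_at p; have ap := chart_dom_chart_at p.
exact (congr1 (mulmx (V p)) (esym (change_of_chart_comp aa ac ad ap cp dp))).
Qed.

Lemma smooth_components V c : smooth_section V -> atlas c ->
  smooth_in (chart_map c @` chart_dom c) (components V c).
Proof. by move=> sV ac; have := sV c ac; rewrite setIT. Qed.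

Lemma differentiable_components V c p : smooth_section V -> atlas c ->
  chart_dom c p -> differentiable (components V c) (chart_map c p).
Proof.
move=> sV ac cp; apply: (smooth_in_differentiable (smooth_components sV ac)).
by exists p.
Qed.

(** The chart used by [courant] varies arbitrarily with the point. Invariance under change of charts
    replaces it, at all points of the domain of [c], by the single chart [c]; smoothness of the
    bracket of sections follows from this. *)
Lemma components_courant V W c p : smooth_section V -> smooth_section W ->
  atlas c -> chart_dom c p ->
  components (courant V W) c (chart_map c p) =
  local_courant (components V c) (components W c) (chart_map c p).
Proof.
move=> sV sW ac cp; rewrite componentsE// /courant.
have := atlas_chart_at p; have := chart_dom_chart_at p.
move: (chart_at p) => a ap aa.
pose U := chart_map a @` (chart_dom a `&` chart_dom c).
have Ux : U (chart_map a p) by exists p.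
have lsub_mul_block (Z Z' : 'rV[R]_(n + n)) (J K : 'M[R]_n) :
    Z' = Z *m block_mx J 0 0 K^T -> lsubmx Z' = lsubmx Z *m J.
  move=> ->; rewrite -{1}[Z]hsubmxK mul_row_block.
  by rewrite !mulmx0 addr0 add0r row_mxKl.
(* Vector parts are pushed forward, while the relation between covector parts is inverted into a
   pull-back, the form that [local_courant_change] takes. *)
have rsub_mul_block (Z Z' : 'rV[R]_(n + n)) (J K : 'M[R]_n) : J *m K = 1%:M ->
    Z' = Z *m block_mx J 0 0 K^T -> rsubmx Z = rsubmx Z' *m J^T.
  move=> JK ->; rewrite -{2}[Z]hsubmxK mul_row_block.
  by rewrite !mulmx0 addr0 add0r row_mxKr -mulmxA -trmx_mul JK trmx1 mulmx1.
have lsubE Z y : U y -> lsubmx (components Z c (transition a c y)) =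
    lsubmx (components Z a y) *m 'J (transition a c) y.
  move=> [q [aq cq] <-]; rewrite transitionE//.
  exact: lsub_mul_block (components_change Z aa ac aq cq).
have rsubE Z y : U y -> rsubmx (components Z a y) =
    rsubmx (components Z c (transition a c y)) *m ('J (transition a c) y)^T.
  move=> [q [aq cq] <-]; rewrite transitionE//.
  exact: rsub_mul_block (jacobian_inverse aa ac aq cq)
    (components_change Z aa ac aq cq).
have JK : 'J (transition a c) (chart_map a p) *m
    'J (transition c a) (chart_map c p) = 1%:M.
  exact: jacobian_inverse.
have dV := differentiable_components sV aa ap.
have dW := differentiable_components sW aa ap.
have dV' := differentiable_components sV ac cp.
have dW' := differentiable_components sW ac cp.
rewrite -(transitionE c ap) in dV' dW'.
have := local_courant_change (@open_chart_overlap a c)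
  (atlas_compatible aa ac) Ux (lsubE V) (lsubE W) (rsubE V) (rsubE W)
  dV dW dV' dW' JK.
by rewrite transitionE// => ->.
Qed.

Lemma smooth_section_courant V W : smooth_section V -> smooth_section W ->
  smooth_section (courant V W).
Proof.
move=> sV sW c ac; rewrite setIT; have oc := @open_chart_codomain c.
have sVW := smooth_in_local_courant oc (smooth_components sV ac)
  (smooth_components sW ac).
apply: (smooth_in_eq oc _ sVW) => _ [p cp <-].
exact: esym (components_courant sV sW ac cp).
Qed.

(** * Operations on smooth sections *)

Lemma smooth_sectionD V W : smooth_section V -> smooth_section W ->
  smooth_section (fun p => V p + W p).
Proof.
move=> sV sW c ac; rewrite setIT.
have -> : components (fun p => V p + W p) c =
    (fun x => components V c x + components W c x).
  by apply/funext => x; rewrite /components mulmxDl.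
by apply: smooth_inD; [exact: open_chart_codomain|exact: smooth_components|
  exact: smooth_components].
Qed.

Lemma components_opp V c :
  components (fun p => - V p) c = (fun x => - components V c x).
Proof. by apply/funext => x; rewrite /components mulNmx. Qed.

Lemma smooth_sectionN V : smooth_section V -> smooth_section (fun p => - V p).
Proof.
move=> sV c ac; rewrite setIT components_opp.
by apply: smooth_inN; [exact: open_chart_codomain|exact: smooth_components].
Qed.

Lemma smooth_sectionB V W : smooth_section V -> smooth_section W ->
  smooth_section (fun p => V p - W p).
Proof.
by move=> sV sW; apply: smooth_sectionD => //; exact: smooth_sectionN.
Qed.

Lemma courantC V W p : smooth_section V -> smooth_section W ->
  courant W V p = - courant V W p.
Proof.
move=> sV sW; have ap := chart_dom_chart_at p; have aa := atlas_chart_at p.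
exact: local_courantC (differentiable_components sV aa ap)
  (differentiable_components sW aa ap).
Qed.

Lemma courantNl V W p : smooth_section V -> smooth_section W ->
  courant (fun q => - V q) W p = - courant V W p.
Proof.
move=> sV sW; have ap := chart_dom_chart_at p; have aa := atlas_chart_at p.
rewrite /courant components_opp.
exact: local_courantNl (differentiable_components sV aa ap)
  (differentiable_components sW aa ap).
Qed.

Lemma courantNr V W p : smooth_section V -> smooth_section W ->
  courant V (fun q => - W q) p = - courant V W p.
Proof.
move=> sV sW; rewrite (courantC _ (smooth_sectionN sW) sV) (courantNl _ sW sV).
by rewrite opprK (courantC _ sV sW).
Qed.

Lemma smooth_apply_endo (Phi : M -> 'M[R]_(n + n)) V :
  smooth_endomorphism Phi -> smooth_section V ->
  smooth_section (apply_endo Phi V).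
Proof.
move=> sPhi sV c ac; rewrite setIT; have oc := @open_chart_codomain c.
have sVPhi := smooth_in_mulmx oc (smooth_components sV ac) (sPhi c ac).
apply: (smooth_in_eq oc _ sVPhi) => _ [p cp <-].
rewrite chart_mapK// (componentsE V cp) (componentsE (apply_endo Phi V) cp).
have aa := atlas_chart_at p; have ap := chart_dom_chart_at p.
(* The change from [c] back to [chart_at p] in the matrix of [Phi] cancels the opposite change in
   the components of [V]. *)
have mulmx_conj (v : 'rV[R]_(n + n)) (A B F : 'M[R]_(n + n)) : A *m B = 1%:M ->
    v *m A *m (B *m F *m A) = v *m F *m A.
  by move=> AB; rewrite !mulmxA -(mulmxA v) AB mulmx1.
apply: mulmx_conj; apply: etrans (change_of_chart_comp aa ac aa ap cp ap) _.
exact: change_of_chart_id.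
Qed.

End Charts.

(** * F-structures and their endomorphisms *)

Lemma neutral_metric_full (K : numFieldType) (n : nat) :
  row_full (neutral_metric K n).
Proof.
rewrite row_full_unit; pose B : 'M[K]_(n + n) := 2 *: block_mx 0 1%:M 1%:M 0.
have AB : neutral_metric K n *m B = 1%:M.
  rewrite /neutral_metric -scalemxAl -scalemxAr scalerA mulVf ?pnatr_eq0//.
  rewrite scale1r mulmx_block !mulmx0 !mul0mx !mulmx1 !addr0 !add0r.
  by rewrite -scalar_mx_block.
by have [] := mulmx1_unit AB.
Qed.

Lemma mxrank_orthogonal (K : numFieldType) (n m : nat) (A : 'M[K]_(m, n + n)) :
  \rank (orthogonal_mx A) = (n + n - \rank A)%N.
Proof.
rewrite mxrank_ker; have := eqmxMfull A^T (neutral_metric_full K n).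
by move=> ->; rewrite mxrank_tr.
Qed.

Lemma eqmx_submx (K : fieldType) m1 m2 k p (A : 'M[K]_(m1, p))
    (B : 'M[K]_(m2, p)) (C : 'M[K]_(k, p)) :
  (A :=: B)%MS -> (A <= C)%MS -> (B <= C)%MS.
Proof. by move=> ->. Qed.

(** The polynomial [X^3 + X] kills an eigenspace whose eigenvalue is one of its roots; this is meant
    for the eigenvalues i, -i and 0. *)
Lemma eigenspace_cubed (K : fieldType) m (P : 'M[K]_m) (a : K) :
  a ^+ 3 = - a -> (eigenspace P a <= kermx (P *m P *m P + P))%MS.
Proof.
move=> a3; apply/sub_kermxP.
have WP := elimT eigenspaceP (submx_refl (eigenspace P a)).
move: (eigenspace P a) WP => W WP; rewrite mulmxDr !mulmxA WP -scalemxAl WP.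
rewrite -scalemxAl -scalemxAl WP !scalerA -scalerDl.
by rewrite -expr2 -exprSr a3 addNr scale0r.
Qed.

Section Pointwise.
Context {R : realType} {n : nat}.
Implicit Types (A : 'M[R[i]]_(n + n)) (F : 'M[R]_(n + n)).

Lemma conj_mxK m k (B : 'M[R[i]]_(m, k)) : conj_mx (conj_mx B) = B.
Proof. by apply/matrixP => i j; rewrite !mxE conjcK. Qed.

(** The decomposition of the complexified fibre into [E], its conjugate and [S_c]. Since [E] meets
    the conjugate of [E'] trivially and the ranks of [E] and [E'] add up to [n + n], the sum of [E]
    and the conjugate of [E'] is everything. The modular law, applicable because [E] is isotropic,
    splits [E'] as [E] plus [S_c]; conjugating splits the conjugate of [E']. *)
Lemma F_structure_full A : (A <= orthogonal_mx A)%MS ->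
  (A :&: conj_mx (orthogonal_mx A))%MS = 0 ->
  (1%:M <= A + conj_mx A + (orthogonal_mx A :&: conj_mx (orthogonal_mx A)))%MS.
Proof.
set O := orthogonal_mx A => AO AO0.
have full : row_full (A + conj_mx O)%MS.
  rewrite /row_full mxrank_disjoint_sum// mxrank_map mxrank_orthogonal.
  by rewrite subnKC// rank_leq_row.
have O_sub : (O <= A + (conj_mx O :&: O))%MS.
  by rewrite (matrix_modl _ AO) sub_capmx submx_full// submx_refl.
have cO_sub : (conj_mx O <= conj_mx A + (O :&: conj_mx O))%MS.
  have := O_sub; rewrite -(map_submx (@conjc _ : {rmorphism R[i] -> R[i]})).
  move=> /submx_trans; apply.
  rewrite map_addsmx addsmxS// map_capmx -!/(conj_mx _) conj_mxK.
  by rewrite submx_refl.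
apply: submx_trans (submx_full _ full) _.
rewrite addsmx_sub -addsmxA addsmxSl /=.
exact: submx_trans cO_sub (addsmxSr _ _).
Qed.

Lemma to_complex_inj m k : injective (@to_complex R m k).
Proof. exact: map_mx_inj. Qed.

Lemma complex_mxE m k (B : 'M[R[i]]_(m, k)) :
  B = to_complex (map_mx (@complex.Re R) B)
      + 'i%C *: to_complex (map_mx (@complex.Im R) B).
Proof. by apply/matrixP => i j; rewrite !mxE -complexE. Qed.

Lemma ReD m k (a b : 'M[R]_(m, k)) :
  map_mx (@complex.Re R) (to_complex a + 'i%C *: to_complex b) = a.
Proof.
by apply/matrixP => i j; rewrite !mxE /= !mul0r mul1r subr0 addr0.
Qed.

Lemma ImD m k (a b : 'M[R]_(m, k)) :
  map_mx (@complex.Im R) (to_complex a + 'i%C *: to_complex b) = b.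
Proof.
by apply/matrixP => i j; rewrite !mxE /= !mul0r mul1r !add0r.
Qed.

Lemma eigenspace_iP F (a b : 'rV[R]_(n + n)) :
  ((to_complex a + 'i%C *: to_complex b)%R <=
     eigenspace (to_complex F) 'i%C)%MS <->
  a *m F = - b /\ b *m F = a.
Proof.
have E1 : (to_complex a + 'i%C *: to_complex b) *m to_complex F =
    to_complex (a *m F) + 'i%C *: to_complex (b *m F).
  by rewrite mulmxDl -scalemxAl /to_complex !map_mxM.
have E2 : 'i%C *: (to_complex a + 'i%C *: to_complex b) =
    to_complex (- b) + 'i%C *: to_complex a.
  by rewrite scalerDr scalerA -expr2 sqr_i scaleN1r addrC /to_complex map_mxN.
split=> [/eigenspaceP H|[aF bF]]; last first.
  by apply/eigenspaceP; apply: etrans E1 (etrans _ (esym E2)); rewrite aF bF.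
have E := etrans (esym E1) (etrans H E2).
have := congr1 (map_mx (@complex.Re R)) E.
by have := congr1 (map_mx (@complex.Im R)) E; rewrite !ReD !ImD.
Qed.

(** The eigenspaces for i, -i and 0 span the fibre, and [P^3 + P] kills each of them. The identity
    descends to real matrices because complexification is injective. *)
Lemma F_structure_cubed A F : (A <= orthogonal_mx A)%MS ->
  (A :&: conj_mx (orthogonal_mx A))%MS = 0 ->
  (eigenspace (to_complex F) 'i%C :=: A)%MS ->
  (eigenspace (to_complex F) (- 'i%C) :=: conj_mx A)%MS ->
  (eigenspace (to_complex F) 0 :=:
     orthogonal_mx A :&: conj_mx (orthogonal_mx A))%MS ->
  F *m F *m F = - F.
Proof.
move=> AO AO0 Ei ENi E0; set P := to_complex F.
have i3 : 'i%C ^+ 3 = - 'i%C :> R[i] by rewrite exprS sqr_i mulrN1.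
have Ni3 : (- 'i%C) ^+ 3 = - - 'i%C :> R[i].
  by rewrite exprNn i3 -signr_odd mulN1r.
have z3 : 0 ^+ 3 = - 0 :> R[i] by rewrite expr0n oppr0.
have : (1%:M <= kermx (P *m P *m P + P))%MS.
  apply: submx_trans (F_structure_full AO AO0) _.
  rewrite addsmx_sub addsmx_sub; apply/andP; split; first (apply/andP; split).
  - exact: eqmx_submx Ei (eigenspace_cubed P i3).
  - exact: eqmx_submx ENi (eigenspace_cubed P Ni3).
  - exact: eqmx_submx E0 (eigenspace_cubed P z3).
move/sub_kermxP; rewrite mul1mx => /eqP; rewrite addr_eq0 => /eqP PPP.
by apply: to_complex_inj; rewrite /to_complex !map_mxM map_mxN.
Qed.

(** This is [pr_S = Id + Phi^2]: in [v = (v + v F^2) - v F^2] the first term lies in the kernel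
    because [F^3 = - F], and the second lies in the image. *)
Lemma proj_kermx F (v : 'rV[R]_(n + n)) : F *m F *m F = - F ->
  v *m proj_mx (kermx F) F = v + v *m F *m F.
Proof.
move=> F3.
have cap0 : (kermx F :&: F)%MS = 0.
  apply/eqP; rewrite -submx0; apply/rV_subP => u; rewrite sub_capmx.
  case/andP=> /sub_kermxP uF /submxP[w uE].
  have : w *m (F *m F *m F) = 0 by rewrite !mulmxA -uE uF mul0mx.
  by rewrite F3 mulmxN -uE => /eqP; rewrite oppr_eq0 => /eqP ->; rewrite sub0mx.
have -> : v *m proj_mx (kermx F) F =
    (v + v *m F *m F) *m proj_mx (kermx F) F
    - (v *m F *m F) *m proj_mx (kermx F) F by rewrite -mulmxBl addrK.
rewrite proj_mx_id//; last first.
  apply/sub_kermxP; rewrite mulmxDl -!mulmxA (mulmxA F) F3 mulmxN.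
  by rewrite addrN.
by rewrite proj_mx_0// ?subr0// submxMl.
Qed.

End Pointwise.

(** * Integrability, the Nijenhuis condition and the vanishing of [S_tensor] *)

Section Proposition.
Context {R : realType} {n : nat} {M : manifold R n}.
Variables (E : M -> 'M[R[i]]_(n + n)) (Phi : M -> 'M[R]_(n + n)).
Implicit Types (V W : bigsection M) (p : M).
Hypothesis sPhi : smooth_endomorphism Phi.
Hypothesis Phi3 : forall p, Phi p *m Phi p *m Phi p = - Phi p.
Hypothesis EPhi : forall p, (eigenspace (to_complex (Phi p)) 'i%C :=: E p)%MS.

Local Notation F := (apply_endo Phi).

Let smooth_F V : smooth_section V -> smooth_section (F V).
Proof. exact: smooth_apply_endo. Qed.

Let F3 V : F (F (F V)) = (fun p => - F V p).
Proof.
by apply/funext => p; rewrite /apply_endo -!mulmxA (mulmxA (Phi p)) Phi3 mulmxN.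
Qed.

Let FN V : F (fun p => - V p) = (fun p => - F V p).
Proof. by apply/funext => p; rewrite /apply_endo mulNmx. Qed.

(** The identity [Phi^3 = - Phi] makes [L] exactly the locus where [Phi^2 = - Id]. *)
Lemma section_of_imageP V :
  section_of_image Phi V <-> smooth_section V /\ F (F V) = (fun p => - V p).
Proof.
split=> [[sV VPhi]|[sV FFV]]; split=> //.
  apply/funext => p; have /submxP[w Vw] := VPhi p.
  by rewrite /apply_endo Vw -!mulmxA (mulmxA (Phi p)) Phi3 mulmxN.
by move=> p; rewrite -[V p]opprK -(congr1 (@^~ p) FFV) eqmx_opp submxMl.
Qed.

Lemma nijenhuis_S_tensor V W p :
  section_of_image Phi V -> section_of_image Phi W ->
  nijenhuis Phi V W p = pr_S Phi (courant V W) p <-> S_tensor Phi V W p = 0.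
Proof.
move=> /section_of_imageP[sV FFV] /section_of_imageP[sW FFW].
have sFV := smooth_F sV; have sFW := smooth_F sW.
have E1 : courant (F (F V)) (F (F W)) p = courant V W p.
  rewrite FFV FFW; apply: etrans (courantNl p sV (smooth_sectionN sW)) _.
  by apply: etrans (congr1 -%R (courantNr p sV sW)) _; rewrite opprK.
have E2 : courant (F V) (F (F W)) p = - courant (F V) W p.
  by rewrite FFW; exact: courantNr.
have E3 : courant (F (F V)) (F W) p = - courant V (F W) p.
  by rewrite FFV; exact: courantNl.
(* With the brackets abstracted to vectors, the term in [Phi^2] of the torsion cancels that of
   [pr_S], and both conditions become [a - v - x *m P - y *m P = 0]. *)
have pointwise (a v x y v' x' y' : 'rV[R]_(n + n)) P :
    P *m P *m P = - P -> v' = v -> x' = - x -> y' = - y ->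
    a - x *m P - y *m P + v *m P *m P = v *m proj_mx (kermx P) P <->
    a - v' + x' *m P + y' *m P = 0.
  move=> P3 -> -> ->; rewrite (proj_kermx v P3) !mulNmx.
  move: (x *m P) (y *m P) (v *m P *m P) => xP yP z.
  rewrite [a - v - xP]addrAC [a - xP - v - yP]addrAC.
  by split=> [/addIr ->|/subr0_eq ->//]; rewrite subrr.
exact: pointwise (Phi3 p) E1 E2 E3.
Qed.

Lemma S_tensor_eq V V' W W' p : F V = F V' -> F W = F W' ->
  S_tensor Phi V W p = S_tensor Phi V' W' p.
Proof. by rewrite /S_tensor => -> ->. Qed.

(** The component of [V] in [L], as [pr_S = Id + Phi^2]. *)
Let L_part V : bigsection M := fun p => - F (F V) p.

Let F_L_part V : F (L_part V) = F V.
Proof.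
have -> : F (L_part V) = (fun p => - F (F (F V)) p).
  by apply/funext => p; rewrite /apply_endo /L_part mulNmx.
by rewrite F3; apply/funext => p; rewrite opprK.
Qed.

Let section_L_part V : smooth_section V -> section_of_image Phi (L_part V).
Proof.
move=> sV; apply/section_of_imageP; split.
  by apply: smooth_sectionN; do 2 apply: smooth_F.
by rewrite F_L_part; apply/funext => p; rewrite /L_part opprK.
Qed.

Lemma nijenhuis_iff_S :
  (forall V W, section_of_image Phi V -> section_of_image Phi W ->
     forall p, nijenhuis Phi V W p = pr_S Phi (courant V W) p) <->
  (forall V W, smooth_section V -> smooth_section W ->
     forall p, S_tensor Phi V W p = 0).
Proof.
split=> [NS|S0] V W sV sW p.
  (* Arbitrary sections are replaced by their components in [L], which have the same images under
     [Phi]. *)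
  rewrite -(S_tensor_eq p (F_L_part V) (F_L_part W)).
  have LV := section_L_part sV; have LW := section_L_part sW.
  exact: (nijenhuis_S_tensor p LV LW).1 (NS _ _ LV LW p).
by apply/(nijenhuis_S_tensor p sV sW)/S0; [case: sV|case: sW].
Qed.

Lemma section_ofP (e : cbigsection M) : section_of E e <->
  [/\ smooth_section (re_section e), smooth_section (im_section e),
      F (re_section e) = (fun p => - im_section e p) &
      F (im_section e) = re_section e].
Proof.
have sub p : (e p <= E p)%MS <->
    re_section e p *m Phi p = - im_section e p /\
    im_section e p *m Phi p = re_section e p.
  by rewrite -EPhi {1}[e p]complex_mxE; exact: eigenspace_iP.
split=> [[[se se'] eE]|[sre sim Fre Fim]].
  split; [by move: se|by move: se'|..].
    by apply/funext => p; have [] := (sub p).1 (eE p).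
  by apply/funext => p; have [] := (sub p).1 (eE p).
split; first by split.
move=> p; apply/sub; split; first exact: (congr1 (@^~ p) Fre).
exact: (congr1 (@^~ p) Fim).
Qed.

Lemma re_ccourant (e f : cbigsection M) : re_section (ccourant e f) =
  (fun p => courant (re_section e) (re_section f) p
            - courant (im_section e) (im_section f) p).
Proof. by apply/funext => p; rewrite /re_section ReD. Qed.

Lemma im_ccourant (e f : cbigsection M) : im_section (ccourant e f) =
  (fun p => courant (re_section e) (im_section f) p
            + courant (im_section e) (re_section f) p).
Proof. by apply/funext => p; rewrite /im_section ImD. Qed.

Lemma integrable_iff_S : integrable_structure E <->
  (forall V W, smooth_section V -> smooth_section W ->
     forall p, S_tensor Phi V W p = 0).
Proof.
split=> [intE V W sV sW p|S0 e f].
  pose e_ (U : bigsection M) : cbigsection M :=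
    fun q => to_complex (F (F U) q) + 'i%C *: to_complex (F U q).
  have ree U : re_section (e_ U) = F (F U).
    by apply/funext => q; rewrite /re_section ReD.
  have ime U : im_section (e_ U) = F U.
    by apply/funext => q; rewrite /im_section ImD.
  have Ee U : smooth_section U -> section_of E (e_ U).
    move=> sU; have sFU := smooth_F sU.
    by apply/section_ofP; rewrite ree ime F3; split => //; exact: smooth_F.
  (* Of the conditions for the bracket to be a section of [E], the one saying that [Phi] maps its
     imaginary part to its real part is already [S_tensor Phi V W p = 0]. *)
  have /section_ofP[_ _ _] := intE _ _ (Ee V sV) (Ee W sW).
  rewrite re_ccourant im_ccourant !ree !ime => /(congr1 (@^~ p)).
  have pointwise (a b c d : 'rV[R]_(n + n)) P :
      (c + d) *m P = a - b -> b - a + d *m P + c *m P = 0.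
    move=> cdP; rewrite -addrA -mulmxDl [d + c]addrC cdP.
    by rewrite subrKA subrr.
  exact: pointwise.
move=> /section_ofP[sV sU FV FU] /section_ofP[sV' sU' FV' FU'].
(* The pair of imaginary parts yields the equation for the imaginary part of the bracket; the real
   part of [e] with the imaginary part of [f] yields the one for its real part. *)
have SU := S0 _ _ sU sU'; have SV := S0 _ _ sV sU'.
apply/section_ofP; rewrite re_ccourant im_ccourant; split.
- by apply: smooth_sectionB; exact: smooth_section_courant.
- by apply: smooth_sectionD; exact: smooth_section_courant.
- have FFV : F (F (re_section e)) = (fun p => - re_section e p).
    by rewrite FV FN FU.
  apply/funext => p; have := SV p; rewrite /S_tensor FFV FV FU' FV' /apply_endo.
  rewrite (courantNl p sU sV') (courantNl p sV (smooth_sectionN sU')).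
  rewrite (courantNr p sV sU') opprK (courantNl p sU (smooth_sectionN sU')).
  rewrite (courantNr p sU sU') opprK (courantNl p sV sV').
  have pointwise (a b c d : 'rV[R]_(n + n)) P :
      - a - b + c *m P + - d *m P = 0 -> (d - c) *m P = - (b + a).
    move/eqP; rewrite -addrA addr_eq0 => /eqP E0.
    by rewrite [b + a]addrC opprD E0 opprD mulNmx opprK mulmxBl addrC.
  exact: pointwise.
- apply/funext => p; have := SU p; rewrite /S_tensor FU FV FU' FV' /apply_endo.
  rewrite (courantNl p sU (smooth_sectionN sU')) (courantNr p sU sU') opprK.
  rewrite (courantNr p sV sU') (courantNl p sU sV').
  have pointwise (a b c d : 'rV[R]_(n + n)) P :
      a - b + - c *m P + - d *m P = 0 -> (c + d) *m P = a - b.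
    move/eqP; rewrite -addrA !mulNmx -opprD subr_eq0 => /eqP ->.
    by rewrite mulmxDl.
  exact: pointwise.
Qed.

End Proposition.

Theorem proposition2p3 (R : realType) (n : nat) (M : manifold R n)
    (E : M -> 'M[complex R]_(n + n)) (Phi : M -> 'M[R]_(n + n)) :
  generalized_F_structure E ->
  corresponding_endomorphism E Phi ->
  let nijenhuis_condition :=
    forall V W : bigsection M,
      section_of_image Phi V -> section_of_image Phi W ->
      forall p : M, nijenhuis Phi V W p = pr_S Phi (courant V W) p in
  let S_condition :=
    forall V W : bigsection M,
      smooth_section V -> smooth_section W ->
      forall p : M, (S_tensor Phi V W p = 0)%R in
  [/\ integrable_structure E <-> nijenhuis_condition,
      integrable_structure E <-> S_condition &
      nijenhuis_condition <-> S_condition].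
Proof.
move=> [_ isoE disjE] [sPhi eigenPhi] N_cond S_cond.
have Phi3 p : Phi p *m Phi p *m Phi p = - Phi p.
  by have [Ei ENi E0] := eigenPhi p; exact: F_structure_cubed Ei ENi E0.
have EPhi p : (eigenspace (to_complex (Phi p)) 'i%C :=: E p)%MS.
  by have [] := eigenPhi p.
have NS : N_cond <-> S_cond := nijenhuis_iff_S sPhi Phi3.
have IS : integrable_structure E <-> S_cond := integrable_iff_S sPhi Phi3 EPhi.
split=> //; exact: iff_trans IS (iff_sym NS).
Qed.
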